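(* Let $R$ be a ring with unity, let $\mathcal{V}$ be a class of $R$-modules, and let $\iota:M\to V$ be a $\mathcal{V}$-preenvelope of an $R$-module $M$ such that $\iota$ is an injection. Then $M$ is trace in $V$ via $\iota$ if and only if $M$ is fully invariant in $V$ via $\iota$.
   Context: $R$ is not necessarily commutative; modules are left modules. For $R$-modules $M,X$, the trace module of $M$ in $X$ is $\tau_M(X)=\sum_{\alpha\in\operatorname{Hom}_R(M,X)}\alpha(M)\subseteq X$. A submodule $M\subseteq X$ is a trace submodule of $X$ if $M=\tau_N(X)$ for some $R$-module $N$. For an injection $\iota:M\to X$, $M$ is trace in $X$ via $\iota$ if $\operatorname{Im}(\iota)$ is a trace submodule of $X$; $M$ is fully invariant in $X$ via $\iota$ if $\varphi(\iota(M))\subseteq\iota(M)$ for every endomorphism $\varphi:X\to X$. A $\mathcal{V}$-preenvelope of $M$ is an $R$-homomorphism $\varphi:M\to V$ with $V\in\mathcal{V}$ such that for any $\psi:M\to V'$ with $V'\in\mathcal{V}$ there exists $\alpha:V\to V'$ with $\alpha\varphi=\psi$. *)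

(* Defs.v *)
From HB Require Import structures.
From mathcomp Require Import all_boot all_order all_algebra.
From mathcomp Require Import boolp classical_sets.

Set Implicit Arguments.
Unset Strict Implicit.
Unset Printing Implicit Defensive.

Import GRing.Theory.

Local Open Scope ring_scope.
Local Open Scope classical_set_scope.

Section TraceModules.
Variable R : pzRingType.

(* An element of the possibly infinite sum of the submodules alpha(M) is a
   finite sum of elements alpha(m); the same alpha may occur repeatedly. *)
Definition trace (M X : lmodType R) : set X :=
  [set x | exists s : seq ({linear M -> X} * M), x = \sum_(p <- s) p.1 p.2].

Arguments trace : clear implicits.

(* No submodule hypothesis on A: it follows from the equation, since
   [trace N X] is a submodule of X. *)
Definition trace_submodule (X : lmodType R) (A : set X) : Prop :=
  exists N : lmodType R, A = trace N X.

Definition trace_via (M X : lmodType R) (iota : {linear M -> X}) : Prop :=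
  trace_submodule (range iota).

Definition fully_invariant_via (M X : lmodType R)
    (iota : {linear M -> X}) : Prop :=
  forall phi : {linear X -> X}, phi @` range iota `<=` range iota.

(* Classes of modules are arbitrary predicates; closure under isomorphism is
   not required. *)
Definition preenvelope (C : lmodType R -> Prop) (M V : lmodType R)
    (phi : {linear M -> V}) : Prop :=
  C V /\ forall (V' : lmodType R) (psi : {linear M -> V'}), C V' ->
    exists alpha : {linear V -> V'}, alpha \o phi =1 psi.

End TraceModules.

Arguments trace {R} M X _.

(* Main.v *)
(* The trace of any module in V is fully invariant, since an endomorphism of V
   composed with a map N -> V is again a map N -> V.  Conversely, the
   preenvelope property factors every map M -> V through iota as an
   endomorphism of V after iota, so if iota(M) is fully invariant, it contains
   the trace of M in V and is therefore equal to it. *)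
Require Import Defs.
From mathcomp Require Import all_boot all_order all_algebra.
From mathcomp Require Import boolp classical_sets.

Import GRing.Theory.

Local Open Scope ring_scope.

(** Additivity moves [phi] inside the finite sum, where it is absorbed into each map [N -> X]. *)
Lemma trace_stable (R : pzRingType) (N X Y : lmodType R) (phi : {linear X -> Y})
    (x : X) : trace N X x -> trace N Y (phi x).
Proof.
case=> s ->.
exists [seq ((phi \o p.1 : {linear N -> Y}), p.2) | p : {linear N -> X} * N <- s].
by rewrite big_map raddf_sum.
Qed.

Lemma range_sub_trace (R : pzRingType) (M X : lmodType R)
    (f : {linear M -> X}) : (range f `<=` trace M X)%classic.
Proof. by move=> _ [m _ <-]; exists [:: (f, m)]; rewrite big_seq1. Qed.

(** The range of a linear map contains 0 and is closed under addition, so single values [g n]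
    suffice. *)
Lemma trace_sub_range (R : pzRingType) (M N X : lmodType R)
    (f : {linear M -> X}) :
  (forall (g : {linear N -> X}) n, range f (g n)) ->
  (trace N X `<=` range f)%classic.
Proof.
move=> fg _ [s ->]; apply: (big_ind (range f)) => [|_ _ [a _ <-] [b _ <-]|p _].
- by exists 0; rewrite ?raddf0.
- by exists (a + b); rewrite ?raddfD.
- exact: fg.
Qed.

Theorem corollary3p4 (R : pzRingType) (C : lmodType R -> Prop)
    (M V : lmodType R) (iota : {linear M -> V})
    (iota_preenv : preenvelope C iota) (iota_inj : injective iota) :
  trace_via iota <-> fully_invariant_via iota.
Proof.
split=> [[N eqN] phi | inv_iota].
  by rewrite eqN => _ [x Nx <-]; apply: trace_stable.
exists M; apply/seteqP; split; first exact: range_sub_trace.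
apply: trace_sub_range => g m.
(* As [V] itself lies in [C], it may serve as the test module, with [g] as the test map; hence
   [g m = phi (iota m)]. *)
have [CV factor] := iota_preenv; have [phi phiE] := factor V g CV.
by apply: (inv_iota phi); exists (iota m); [exists m | exact: phiE].
Qed.
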